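(* Let $C=\{e,(1,2,3),(1,3,2)\}\subset S_3$ be the set of cyclic permutations of $\{1,2,3\}$. For every positive integer $d$, $$\operatorname{disc}([3]^d,\mathcal A_C^+)\ \ge\ \left\lfloor \frac{d}{4\sqrt2}\right\rfloor .$$
   Context: For a finite set $\Omega$ and a finite collection $\mathcal A$ of subsets of $\Omega$, the discrepancy is $$\operatorname{disc}(\Omega,\mathcal A)=\min_{\chi:\Omega\to\{+1,-1\}}\ \max_{S\in\mathcal A}|\chi(S)|,\qquad \chi(S)=\sum_{x\in S}\chi(x).$$ Write $[3]=\{1,2,3\}$; $[3]^d$ is the set of strings $\boldsymbol a=a_1a_2\cdots a_d$ of length $d$ over $[3]$. A permutation $\sigma$ of $[3]$ acts digitwise: $\sigma\cdot\boldsymbol a=\sigma(a_1)\sigma(a_2)\cdots\sigma(a_d)$. Let $<$ be the lexicographic order on $[3]^d$. For a permutation $\sigma$ and $\boldsymbol a\in[3]^d$ let $$E_{\sigma,\boldsymbol a}=\{\boldsymbol b\in[3]^d:\ \sigma\cdot\boldsymbol b<\sigma\cdot\boldsymbol a\}.$$ For a set $P$ of permutations of $[3]$, $\mathcal A_P$ is the collection of all sets $E_{\sigma,\boldsymbol a}$ with $\sigma\in P$ and $\boldsymbol a\in[3]^d$, and $\mathcal A_P^+$ is the union of $\mathcal A_P$ with $\{[3]^d\}$ (i.e. the full set $[3]^d$ is added as a member). *)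

(* Defs.v *)
From mathcomp Require Import all_boot all_order all_fingroup all_algebra.
From mathcomp Require Import reals.

Set Implicit Arguments.
Unset Strict Implicit.
Unset Printing Implicit Defensive.

Import Order.TTheory GRing.Theory Num.Theory.
Local Open Scope ring_scope.

(* A colouring chi : T -> {+1, -1} is encoded by a boolean function, with the
   colour of x being (-1) ^+ chi x; csum chi S is chi(S). *)
Definition csum (T : finType) (chi : {ffun T -> bool}) (S : {set T}) : int :=
  \sum_(x in S) (-1) ^+ chi x.

(* The maximum is 0 if A is empty. *)
Definition max_csum (T : finType) (A : {set {set T}}) (chi : {ffun T -> bool})
    : nat :=
  \max_(S in A) `|csum chi S|%N.

(* The constant colouring only witnesses that there is a colouring. *)
Definition disc (T : finType) (A : {set {set T}}) : nat :=
  max_csum A [arg min_(chi < [ffun=> false] : {ffun T -> bool}) max_csum A chi].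

(* The digits 1, 2, 3 are the elements 0, 1, 2 of 'I_3, in the same order. *)
Definition act_digits (d : nat) (s : 'S_3) (a : d.-tuple 'I_3) :
    d.-tuple 'I_3 :=
  [tuple of map s a].

(* d.-tuplelexi carries the lexicographic order on d.-tuple. *)
Definition initial_seg (d : nat) (s : 'S_3) (a : d.-tuple 'I_3) :
    {set d.-tuple 'I_3} :=
  [set b : d.-tuple 'I_3 |
     ((act_digits s b : d.-tuplelexi 'I_3) < act_digits s a)%O].

Definition seg_family (d : nat) (P : {set 'S_3}) : {set {set d.-tuple 'I_3}} :=
  [set initial_seg s a | s in P, a in [set: d.-tuple 'I_3]].

Definition seg_family_plus (d : nat) (P : {set 'S_3}) :
    {set {set d.-tuple 'I_3}} :=
  [set: d.-tuple 'I_3] |: seg_family d P.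

(* Addition in 'I_3 is modulo 3, so these are the cycles (1,2,3) and (1,3,2). *)
Definition cyc123 : 'S_3 := perm (addrI (1 : 'I_3)).
Definition cyc132 : 'S_3 := perm (addrI (-1 : 'I_3)).

Definition cyclic_perms : {set 'S_3} := [set 1%g; cyc123; cyc132].

(* Main.v *)
Require Import Defs.
From mathcomp Require Import all_boot all_order all_fingroup all_algebra.
From mathcomp Require Import reals.
From mathcomp Require Import zify ring lra.

Import Order.TTheory GRing.Theory Num.Theory.
Local Open Scope ring_scope.

(** View the strings of length d as the leaves of a ternary tree of depth d whose
    nodes are the prefixes, and give every node the sum of the colours below it.
    An initial segment ending at the leaf a is cut out by the path to a: at each
    node of the path it collects the children lying before the next digit.

    Let x_0, x_1, x_2 be the values of the children of a node of value
    x = x_0 + x_1 + x_2, and let the path leave through the child c.  In the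
    three cyclic orders of the digits, c is preceded by no child, by its cyclic
    predecessor c - 1, and by both other children, so the three segments collect
    x + x_(c-1) - x_c altogether ([cyclic_sum_cons]).  It therefore suffices to
    find a path on which this sum G is large, of order d, and to divide by 3.

    The path is chosen greedily.  Every node has an odd number of leaves, so its
    value is a nonzero integer, and this makes it possible to choose c with
    x_(c-1) + min(0, x_c) >= min(0, x) + 1 ([cyclic_step]).  Hence the lower
    bound x + min(0, x) + d - 1 for G passes from the child c to its parent with
    a gain of 1 per level ([cyclic_sum_lower_bound]).  If the total of all
    colours is positive it is at least 1 and G >= d; otherwise the same applies
    to the opposite colouring.  So every colouring has a segment of absolute
    sum at least d / 3 ([max_csum_ge]), which exceeds d / (4 sqrt 2). *)

Definition subtree {d : nat} (f : d.+1.-tuple 'I_3 -> int) (i : 'I_3) :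
    d.-tuple 'I_3 -> int :=
  fun t => f [tuple of i :: t].

(** Adding up the three cyclic orders is what makes the contribution of a node
    depend on the digit only through its cyclic neighbours. *)
Definition cyclic_sum {d : nat} (f : d.-tuple 'I_3 -> int) (a : d.-tuple 'I_3) :
    int :=
  \sum_(b in initial_seg 1 a) f b + \sum_(b in initial_seg cyc123 a) f b
  + \sum_(b in initial_seg cyc132 a) f b.

Lemma ord3_ind (P : 'I_3 -> Prop) :
  P ord0 -> P (inord 1) -> P (inord 2) -> forall i, P i.
Proof.
move=> P0 P1 P2 [[|[|[|m]]] lt_m3] //.
- by rewrite (_ : Ordinal lt_m3 = ord0); last exact: val_inj.
- by rewrite (_ : Ordinal lt_m3 = inord 1); last by apply: val_inj; rewrite /= inordK.
- by rewrite (_ : Ordinal lt_m3 = inord 2); last by apply: val_inj; rewrite /= inordK.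
Qed.

Lemma ord3_pred :
  [/\ (ord0 : 'I_3) - 1 = inord 2, (inord 1 : 'I_3) - 1 = ord0
    & (inord 2 : 'I_3) - 1 = inord 1].
Proof. by split; apply: val_inj; rewrite /= !inordK. Qed.

Lemma big_ord3 (F : 'I_3 -> int) :
  \sum_i F i = F ord0 + F (inord 1) + F (inord 2).
Proof.
rewrite !big_ord_recl big_ord0 addr0 addrA; congr (_ + F _ + F _);
  by apply: val_inj; rewrite /= inordK.
Qed.

Lemma big_tuple_nil (f : 0.-tuple 'I_3 -> int) : \sum_b f b = f [tuple].
Proof. by rewrite (big_pred1 [tuple]) // => b; apply/esym/eqP; exact: tuple0. Qed.

Lemma big_tuple_cons (d : nat) (P : pred (d.+1.-tuple 'I_3))
    (f : d.+1.-tuple 'I_3 -> int) :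
  \sum_(b | P b) f b =
  \sum_i \sum_(t : d.-tuple 'I_3 | P [tuple of i :: t]) f [tuple of i :: t].
Proof.
rewrite pair_big_dep /=.
rewrite (reindex (fun p : 'I_3 * d.-tuple 'I_3 => [tuple of p.1 :: p.2])) //=.
exists (fun b => (thead b, [tuple of behead b])) => [[i t] _ | b _] /=.
  by congr pair; apply: val_inj.
by rewrite -tuple_eta.
Qed.

Lemma total_cons (d : nat) (f : d.+1.-tuple 'I_3 -> int) :
  \sum_b f b = \sum_i \sum_t subtree f i t.
Proof. exact: (big_tuple_cons _ xpredT). Qed.

(** The digits are permuted before they are compared, but equality of first
    digits is unaffected since a permutation is injective. *)
Lemma mem_initial_seg_cons (d : nat) (s : 'S_3) (i c : 'I_3)
    (t a : d.-tuple 'I_3) :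
  ([tuple of i :: t] \in initial_seg s [tuple of c :: a]) =
  (s i < s c)%O || (i == c) && (t \in initial_seg s a).
Proof.
rewrite !inE.
have -> : ((act_digits s [tuple of i :: t] : d.+1.-tuplelexi 'I_3)
            < act_digits s [tuple of c :: a])%O =
    (s i <= s c)%O && ((s c <= s i)%O ==>
      ((act_digits s t : d.-tuplelexi 'I_3) < act_digits s a)%O).
  by rewrite [LHS]ltxi_cons.
rewrite -(inj_eq (@perm_inj _ s)).
by case: (ltgtP (s i) (s c)).
Qed.

Lemma initial_seg_sum_cons (d : nat) (f : d.+1.-tuple 'I_3 -> int) (s : 'S_3)
    (c : 'I_3) (a : d.-tuple 'I_3) :
  \sum_(b in initial_seg s [tuple of c :: a]) f b =
  \sum_(i | (s i < s c)%O) \sum_t subtree f i t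
  + \sum_(t in initial_seg s a) subtree f c t.
Proof.
rewrite big_tuple_cons (bigID (fun i => (s i < s c)%O)) /=; congr (_ + _).
  apply: eq_bigr => i lt_ic; apply: eq_bigl => t.
  by rewrite mem_initial_seg_cons lt_ic.
rewrite (bigD1 c) ?ltxx //= [X in _ + X]big1 ?addr0.
  by apply: eq_bigl => t; rewrite mem_initial_seg_cons ltxx eqxx.
move=> i /andP[/negbTE nlt_ic /negbTE neq_ic]; rewrite big_pred0 // => t.
by rewrite mem_initial_seg_cons nlt_ic neq_ic.
Qed.

(** In the three orders, the children before c are: none, the predecessor c - 1,
    and both c - 1 and c + 1.  Their values add up to
    x_(c-1) + (x_(c-1) + x_(c+1)) = x + x_(c-1) - x_c. *)
Lemma cyclic_sum_cons (d : nat) (f : d.+1.-tuple 'I_3 -> int) (c : 'I_3)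
    (a : d.-tuple 'I_3) :
  cyclic_sum f [tuple of c :: a] =
  \sum_b f b + \sum_t subtree f (c - 1) t - \sum_t subtree f c t
  + cyclic_sum (subtree f c) a.
Proof.
rewrite /cyclic_sum !initial_seg_sum_cons total_cons !big_ord3.
set X := fun i => \sum_t subtree f i t.
(* Sums over all three digits, so that each comparison of digits computes. *)
have E (s : 'S_3) : \sum_(i | (s i < s c)%O) \sum_t subtree f i t =
    \sum_i (if (s i < s c)%O then X i else 0) by rewrite big_mkcond.
rewrite !E !big_ord3 !perm1 !permE /= -![\sum_t subtree _ _ t]/(X _).
clear E; move: X => X; move: (\sum_(t in initial_seg 1 a) _) => s1.
move: (\sum_(t in initial_seg cyc123 a) _) => s2.
move: (\sum_(t in initial_seg cyc132 a) _) => s3.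
have [e0 e1 e2] := ord3_pred.
elim/ord3_ind: c; rewrite ?e0 ?e1 ?e2 !ltEord /= !inordK //=; ring.
Qed.

(** There are 3 ^ d leaves, an odd number; what matters later is that the value
    of a node cannot vanish. *)
Lemma total_odd (d : nat) (f : d.-tuple 'I_3 -> int) :
  (forall b, `|f b| = 1) -> odd (absz (\sum_b f b)).
Proof.
elim: d f => [|d IHd] f f1.
  by rewrite big_tuple_nil; have := f1 [tuple]; lia.
rewrite total_cons big_ord3.
have IH i := IHd (subtree f i) (fun t => f1 _).
have := IH ord0; have := IH (inord 1); have := IH (inord 2).
lia.
Qed.

(** Two positive values among three are cyclically adjacent; as x_(c-1) and x_c
    they give x_(c-1) >= 1.  If at most one value is positive, let c be the
    successor of the largest: x_c and x_(c+1) are negative, so the right-hand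
    side is the total minus x_(c+1), which exceeds the total by at least 1. *)
Lemma cyclic_step (x : 'I_3 -> int) : (forall i, x i != 0) ->
  exists c, Num.min 0 (\sum_i x i) + 1 <= x (c - 1) + Num.min 0 (x c).
Proof.
move=> x0; rewrite big_ord3.
have [e0 e1 e2] := ord3_pred.
have := x0 ord0; have := x0 (inord 1); have := x0 (inord 2).
set u := x ord0; set v := x (inord 1); set w := x (inord 2) => w0 v0 u0.
have [H|H0] := boolP (Num.min 0 (u + v + w) + 1 <= w + Num.min 0 u).
  by exists ord0; rewrite e0.
have [H|H1] := boolP (Num.min 0 (u + v + w) + 1 <= u + Num.min 0 v).
  by exists (inord 1); rewrite e1.
exists (inord 2); rewrite e2 -/v -/w; lia.
Qed.

(** The term min(0, total) keeps the bound inductive when the path enters a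
    subtree of negative value.  The constant -1 comes from the leaves, where
    the left-hand side is 0 for the colour 1 and -3 for the colour -1, while the
    sum over segments is empty. *)
Lemma cyclic_sum_lower_bound (d : nat) (f : d.-tuple 'I_3 -> int) :
  (forall b, `|f b| = 1) ->
  exists a, \sum_b f b + Num.min 0 (\sum_b f b) + d%:Z - 1 <= cyclic_sum f a.
Proof.
elim: d f => [|d IHd] f f1.
  have seg0 s : \sum_(b in initial_seg s [tuple]) f b = 0.
    by rewrite big_pred0 // => b; rewrite inE [LHS]ltxis0.
  exists [tuple]; rewrite /cyclic_sum !seg0.
  by rewrite big_tuple_nil; have := f1 [tuple]; lia.
have [i|c] := @cyclic_step (fun i => \sum_t subtree f i t).
  have := total_odd _ (subtree f i) (fun t => f1 _); lia.
rewrite -total_cons; cbv beta => step.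
have [a IHa] := IHd (subtree f c) (fun t => f1 _).
exists [tuple of c :: a]; rewrite cyclic_sum_cons; move: step IHa.
move: (\sum_b f b) (\sum_t subtree f (c - 1) t) (\sum_t subtree f c t).
by move: (cyclic_sum _ _) => s total pred own; lia.
Qed.

Lemma cyclic_sumN (d : nat) (f : d.-tuple 'I_3 -> int) a :
  cyclic_sum (fun b => - f b) a = - cyclic_sum f a.
Proof. by rewrite /cyclic_sum !sumrN !opprD. Qed.

Lemma cyclic_sum_le (d : nat) (chi : {ffun d.-tuple 'I_3 -> bool}) a :
  `|cyclic_sum (fun b => (-1) ^+ chi b) a|
    <= 3 * (max_csum (seg_family_plus d cyclic_perms) chi)%:Z.
Proof.
have bound s : s \in cyclic_perms ->
    `|\sum_(b in initial_seg s a) (-1) ^+ chi b|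
      <= (max_csum (seg_family_plus d cyclic_perms) chi)%:Z :> int.
  move=> sC; rewrite -[`|_|]/(`|csum chi (initial_seg s a)|) -abszE lez_nat.
  apply: leq_bigmax_cond; apply/setU1P; right.
  by apply/imset2P; exists s a.
have := bound 1%g; have := bound cyc123; have := bound cyc132.
rewrite !inE !eqxx !orbT /= => /(_ isT) b3 /(_ isT) b2 /(_ isT) b1.
rewrite -[3]/(1 + 1 + 1 : int) !mulrDl !mul1r.
apply: le_trans (ler_normD _ _) (lerD _ b3).
exact: le_trans (ler_normD _ _) (lerD b1 b2).
Qed.

(** The lower bound on the sum over the three orders is useful only for a
    positive total, so the colouring and its opposite are both considered; the
    total, being odd, is positive for one of them. *)
Lemma max_csum_ge (d : nat) (chi : {ffun d.-tuple 'I_3 -> bool}) :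
  (d <= 3 * max_csum (seg_family_plus d cyclic_perms) chi)%N.
Proof.
pose f b : int := (-1) ^+ chi b.
have f1 b : `|f b| = 1 by rewrite normrX normrN1 expr1n.
have := total_odd _ _ f1.
have [a] := cyclic_sum_lower_bound _ _ f1.
have Nf1 b : `|- f b| = 1 by rewrite normrN.
have [a'] := cyclic_sum_lower_bound _ (fun b => - f b) Nf1.
rewrite cyclic_sumN sumrN.
have := cyclic_sum_le _ chi a; have := cyclic_sum_le _ chi a'; rewrite -/f.
move: (max_csum _ _) (\sum_b f b) (cyclic_sum f a) (cyclic_sum f a').
by move=> D total s s'; lia.
Qed.

Theorem corollary2p2 (R : realType) (d : nat) (hd : (0 < d)%N) :
  Num.floor (d%:R / (4 * Num.sqrt 2) : R)
    <= (disc (seg_family_plus d cyclic_perms))%:Z.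
Proof.
set D := disc _.
have dD : (d <= 3 * D)%N by exact: max_csum_ge.
have sqrt2_ge1 : 1 <= Num.sqrt 2 :> R by rewrite -{1}sqrtr1 ler_wsqrtr // ler1n.
have dDR : d%:R <= 3 * D%:R :> R by rewrite -natrM ler_nat.
rewrite -(ler_int R); apply: le_trans (floor_le _) _.
rewrite ler_pdivrMr; last by lra.
have : 0 <= D%:R :> R by [].
rewrite -pmulrn; nra.
Qed.
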